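(* Let $n\ge 4$ and $k\ge 1$ be integers. If $k\neq 2$, then $\pi(P_n[E_k])=2k+1$. If $k=2$, then $5\le \pi(P_n[E_2])\le 6$.
   Context: $P_n$ is the path on $n$ vertices and $E_k$ is the empty (edgeless) graph on $k$ vertices. The lexicographic product $G[H]$ of graphs $G=(V_1,E_1)$ and $H=(V_2,E_2)$ has vertex set $V_1\times V_2$, and $(v_1,v_2)$ is joined to $(v_1',v_2')$ if either $(v_1,v_1')\in E_1$, or $v_1=v_1'$ and $(v_2,v_2')\in E_2$. A sequence $x_1\ldots x_{2l}$ ($l\ge 1$) is a repetition if $x_i=x_{l+i}$ for all $1\le i\le l$. A vertex coloring $c$ of a graph $G$ is nonrepetitive if there is no path $v_1,\ldots,v_{2l}$ in $G$ (with distinct vertices, $l\ge1$) such that $c(v_1),\ldots,c(v_{2l})$ is a repetition. The Thue chromatic number $\pi(G)$ is the least number of colors in a nonrepetitive coloring of $G$. *)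

(* Defs.v *)
From mathcomp Require Import all_boot.
From mathcomp Require Import boolp.

Set Implicit Arguments.
Unset Strict Implicit.
Unset Printing Implicit Defensive.

Record sgraph := SGraph {
  vertex :> finType;
  adj : rel vertex;
  adj_sym : symmetric adj;
  adj_irr : irreflexive adj
}.

Section PathGraph.
Variable n : nat.

Definition path_adj (i j : 'I_n) : bool := (i.+1 == j) || (j.+1 == i).

Lemma path_adj_sym : symmetric path_adj.
Proof. by move=> i j; rewrite /path_adj orbC. Qed.

Lemma path_adj_irr : irreflexive path_adj.
Proof. by move=> i; rewrite /path_adj orbb eqn_leq ltnn. Qed.

Definition path_graph : sgraph := SGraph path_adj_sym path_adj_irr.

End PathGraph.

Section EmptyGraph.
Variable k : nat.

Definition empty_adj (i j : 'I_k) : bool := false.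

Lemma empty_adj_sym : symmetric empty_adj. Proof. by []. Qed.

Lemma empty_adj_irr : irreflexive empty_adj. Proof. by []. Qed.

Definition empty_graph : sgraph := SGraph empty_adj_sym empty_adj_irr.

End EmptyGraph.

Section LexProduct.
Variables G H : sgraph.

Definition lex_adj (u v : G * H) : bool :=
  adj u.1 v.1 || ((u.1 == v.1) && adj u.2 v.2).

Lemma lex_adj_sym : symmetric lex_adj.
Proof.
by move=> u v; rewrite /lex_adj (adj_sym u.1) (adj_sym u.2) (eq_sym u.1).
Qed.

Lemma lex_adj_irr : irreflexive lex_adj.
Proof. by move=> u; rewrite /lex_adj !adj_irr andbF. Qed.

Definition lex_product : sgraph := SGraph lex_adj_sym lex_adj_irr.

End LexProduct.

Definition repetition (A : Type) (x : seq A) : Prop :=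
  exists l : nat,
    [/\ 0 < l, size x = 2 * l
      & forall i : nat, i < l -> onth x i = onth x (l + i)].

Definition graph_path (G : sgraph) (p : seq G) : bool :=
  uniq p && sorted (@adj G) p.

Definition nonrepetitive (G : sgraph) (A : Type) (c : G -> A) : Prop :=
  forall p : seq G, graph_path p -> ~ repetition (map c p).

Definition nonrep_colorable (G : sgraph) (m : nat) : Prop :=
  exists c : G -> 'I_m, nonrepetitive c.

(* Giving every vertex its own color is nonrepetitive, so the minimum below
   is taken over a nonempty set. *)
Lemma nonrep_colorable_card (G : sgraph) : nonrep_colorable G #|G|.
Proof.
exists enum_rank => p /andP[up _] [l [l_gt0 szp rep]].
have us : uniq (map enum_rank p) by rewrite (map_inj_uniq (@enum_rank_inj G)).
have lt0 : 0 < size (map enum_rank p) by rewrite szp muln_gt0.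
have ltl : l < size (map enum_rank p) by rewrite szp ltn_Pmull.
have /= := rep 0 l_gt0; rewrite addn0.
case def_s: (map enum_rank p) us lt0 ltl => [//|x s] us lt0 ltl e.
have : nth x (x :: s) 0 = nth x (x :: s) l by rewrite -(odflt_onth x _ l) -e.
by move/eqP; rewrite nth_uniq // eq_sym eqn0Ngt l_gt0.
Qed.

Lemma nonrep_colorable_ex (G : sgraph) :
  exists m : nat, `[< nonrep_colorable G m >].
Proof. by exists #|G|; apply/asboolP/nonrep_colorable_card. Qed.

Definition thue_number (G : sgraph) : nat := ex_minn (nonrep_colorable_ex G).

(* Main.v *)
Require Import Defs.
From mathcomp Require Import all_boot.
From mathcomp Require Import zify boolp.

(** Call the copy of [E_k] over the i-th vertex of [P_n] the i-th layer.

Lower bound.  Look at four consecutive layers.  If an inner layer has a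
repeated colour [a], then no colour [b] can occur twice in the two layers
around it, since [b a b a] would be the colouring of a path; these layers then
use 2k colours, and [a] is one more ([middle_layer_rainbow]).  Otherwise both
inner layers are rainbow, and with 2k colours their palettes partition all the
colours.  Each outer layer must then draw its colours from the inner layer that
is not adjacent to it, and some path through the four layers in order is
coloured [a b a b] ([layered_lower_bound]).

Upper bound for k > 1.  Split the colours into a set [R] with k elements and a
set [X] with max(k + 1, 4) elements, and colour the layers with period four:
[R], [a_j], [X - a_j], [a_j].  A layer marked by a set receives k distinct
colours of that set, and a layer marked [a_j] is entirely coloured [a_j].  The
colours [a_j] form a squarefree sequence over [X] without factors [aba], which
exists as soon as [X] has four elements.  The layers from 4j + 1 to 4j + 3 form
the j-th block.

Suppose that a path of this graph is coloured by a repetition, with halves of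
length l.  Matched positions of even layers have distinct vertices of the same
colour, hence lie in different layers.  If l is odd, even layers are matched
with odd ones, so the path avoids [R], stays in one block, and there [a_j]
would have to match a colour of [X - a_j].  If l is even, the positions in odd
layers describe a walk on the blocks which stays or moves by one at each step,
and whose colours [a_j] form a repetition.  Such a walk must visit the same
block at matched positions ([walk_repetition]).  So a visit to the middle of a
block would be matched with a visit to the same layer.  The path therefore
never visits the middle of a block, and stays around a single layer coloured by
[R], to which it returns at matched positions: a contradiction.

When k = 1 a path of the graph moves monotonically, and any squarefree ternary
sequence will do.  Squarefree sequences come from the Thue-Morse sequence
([thue_morse_overlap_free]). *)

(** * The Thue-Morse sequence *)

(** The parity of the binary digit sum; [d] bounds the number of digits read. *)
Fixpoint thue_morse_fuel (d n : nat) : bool :=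
  if d is d'.+1 then odd n (+) thue_morse_fuel d' n./2 else false.

Definition thue_morse (n : nat) : bool := thue_morse_fuel n n.

Lemma thue_morse_fuelE d n : n <= d -> thue_morse_fuel d n = thue_morse n.
Proof.
rewrite /thue_morse; elim/ltn_ind: n d => -[|n] IH [|d] //= le_nd.
  by elim: d {le_nd} => //= d ->.
by rewrite !IH //; lia.
Qed.

Lemma thue_morse_half n : thue_morse n = odd n (+) thue_morse n./2.
Proof.
case: n => // n; rewrite {1}/thue_morse /= thue_morse_fuelE //; lia.
Qed.

Lemma thue_morse_even n : thue_morse n.*2 = thue_morse n.
Proof. by rewrite thue_morse_half odd_double doubleK. Qed.

Lemma thue_morse_odd n : thue_morse n.*2.+1 = ~~ thue_morse n.
Proof. by rewrite thue_morse_half /= odd_double uphalf_double. Qed.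

Lemma thue_morse_cube x :
  thue_morse x = thue_morse x.+1 -> thue_morse x.+1 = thue_morse x.+2 -> False.
Proof.
case: (boolP (odd x)) => [ox|/even_halfK <-]; last first.
  by rewrite thue_morse_even thue_morse_odd; case: thue_morse.
have -> : x = x./2.*2.+1 by lia.
by rewrite -doubleS thue_morse_even !thue_morse_odd => _; case: thue_morse.
Qed.

(** Descent on the period [p].  For even [p], restricting to the indices of one
parity gives an overlap of period [p./2].  The case [p = 1] is a cube.  For odd [p > 1], consecutive values
differ at every even index, and the overlap transports this to every odd index;
but two alternations at consecutive odd indices give a cube among the halved
indices. *)
Lemma thue_morse_overlap_free p x :
  0 < p -> ~ (forall i, i <= p -> thue_morse (x + i) = thue_morse (x + p + i)).
Proof.
elim/ltn_ind: p x => p IH x p0 E.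
case: (boolP (odd p)) => [op|/even_halfK ep]; last first.
  apply: (IH p./2 _ x./2) => [||i le_i]; [lia..|].
  have {}E := E i.*2 ltac:(lia).
  case: (boolP (odd x)) => ox.
    move: E; have -> : x + i.*2 = (x./2 + i).*2.+1 by lia.
    have -> : x + p + i.*2 = (x./2 + p./2 + i).*2.+1 by lia.
    by rewrite !thue_morse_odd => /negb_inj.
  move: E; have -> : x + i.*2 = (x./2 + i).*2 by lia.
  have -> : x + p + i.*2 = (x./2 + p./2 + i).*2 by lia.
  by rewrite !thue_morse_even.
have even_step y : ~~ odd y -> thue_morse y <> thue_morse y.+1.
  by move=> /even_halfK <-; rewrite thue_morse_even thue_morse_odd; case: thue_morse.
have step i : i < p -> thue_morse (x + i) <> thue_morse (x + i).+1
    /\ thue_morse (x + p + i) <> thue_morse (x + p + i).+1.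
  move=> lt_ip; have := E i (ltnW lt_ip); have := E i.+1 lt_ip.
  rewrite !addnS => E1 E0.
  case: (boolP (odd (x + i))) => oxi.
    by rewrite E0 E1; split; apply: even_step; lia.
  by rewrite -E0 -E1; split; apply: even_step.
have alt y : x <= y < x + p.*2 -> thue_morse y <> thue_morse y.+1.
  move=> Hy; have [lt_y|le_y] := ltnP y (x + p).
    by have [+ _] := step (y - x) ltac:(lia); rewrite subnKC //; lia.
  by have [_] := step (y - (x + p)) ltac:(lia); rewrite subnKC //; lia.
have [p1|p3] : p = 1 \/ 3 <= p by lia.
  have := E 0 isT; have := E 1; rewrite p1 !addn0 !addn1 => E1 E0.
  exact: thue_morse_cube E0 (E1 isT).
have pair z : x <= z.*2.+1 < x + p.*2 -> thue_morse z = thue_morse z.+1.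
  by move/alt; rewrite thue_morse_odd -doubleS thue_morse_even; do 2!case: thue_morse.
by apply: (@thue_morse_cube x./2); apply: pair; lia.
Qed.

(** * Squarefree sequences over three and four letters *)

Definition squarefree {A : Type} (s : nat -> A) : Prop :=
  forall x l, 0 < l -> ~ (forall i, i < l -> s (x + i) = s (x + l + i)).

Lemma squarefree_inj (A B : Type) (g : A -> B) (s : nat -> A) :
  injective g -> squarefree s -> squarefree (g \o s).
Proof. by move=> g_inj sf x l l0 E; apply: (sf x l l0) => i /E /g_inj. Qed.

Lemma squarefree_step (A : Type) (s : nat -> A) x :
  squarefree s -> s x <> s x.+1.
Proof. by move=> /(_ x 1 isT) sf E; apply: sf => -[|//] _; rewrite addn1 !addn0. Qed.

(** The derivative of the Thue-Morse sequence: whether it stays constant, and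
otherwise in which direction it jumps. *)
Definition ternary (n : nat) : option bool :=
  if thue_morse n == thue_morse n.+1 then None else Some (thue_morse n).

(** The letters tell whether Thue-Morse changes, so along a square the shifted
values either agree throughout or differ throughout.  Agreement is an overlap.
A jump tells the value at its index, so if the values differ there are no jumps
at all, which gives a cube. *)
Lemma ternary_squarefree : squarefree ternary.
Proof.
move=> x l l0 E.
have chg i : i < l -> (thue_morse (x + i) == thue_morse (x + l + i))
                   = (thue_morse (x + i.+1) == thue_morse (x + l + i.+1)).
  move=> /E; rewrite /ternary !addnS.
  by do 4!case: thue_morse.
have const i : i <= l -> (thue_morse (x + i) == thue_morse (x + l + i))
                         = (thue_morse x == thue_morse (x + l)).
  by elim: i => [|i IH] le_i; rewrite ?addn0 // -chg // IH // ltnW.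
have [/eqP E0|/eqP N0] := boolP (thue_morse x == thue_morse (x + l)).
  by apply: (thue_morse_overlap_free l x l0) => i /const; rewrite E0 eqxx => /eqP.
have flat i : i < l -> thue_morse (x + i) = thue_morse (x + i).+1
                  /\ thue_morse (x + l + i) = thue_morse (x + l + i).+1.
  move=> lt_il; move: (E i lt_il) (const i (ltnW lt_il)); rewrite (introF eqP N0).
  by rewrite /ternary; do 4!case: thue_morse.
have [l1|l2] : l = 1 \/ 1 < l by lia.
  have := flat 0 l0; rewrite l1 !addn0 addn1 => -[]; exact: thue_morse_cube.
have [+ _] := flat 0 l0; have [+ _] := flat 1 l2; rewrite addn0 addn1 => E1 E0.
exact: thue_morse_cube E0 E1.
Qed.

(** The ternary sequence with a fourth letter [None] inserted after every second
letter, which separates the two equal letters of each factor [aba]. *)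
Definition quaternary (n : nat) : option (option bool) :=
  if n %% 3 == 2 then None else Some (ternary (n %/ 3 * 2 + n %% 3)).

Lemma quaternary_step n : quaternary n <> quaternary n.+1.
Proof.
rewrite /quaternary.
have [E|[E|E]] : n %% 3 = 0 \/ n %% 3 = 1 \/ n %% 3 = 2 by lia.
- have [-> ->] : n.+1 %/ 3 = n %/ 3 /\ n.+1 %% 3 = 1 by lia.
  by rewrite E addn0 addn1 /= => -[]; apply: squarefree_step ternary_squarefree.
- have -> : n.+1 %% 3 = 2 by lia.
  by rewrite E.
- have -> : n.+1 %% 3 = 0 by lia.
  by rewrite E.
Qed.

Lemma quaternary_no_aba n : quaternary n <> quaternary n.+2.
Proof.
rewrite /quaternary.
have [E|[E|E]] : n %% 3 = 0 \/ n %% 3 = 1 \/ n %% 3 = 2 by lia.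
- have -> : n.+2 %% 3 = 2 by lia.
  by rewrite E.
- have [-> ->] : n.+2 %/ 3 = (n %/ 3).+1 /\ n.+2 %% 3 = 0 by lia.
  rewrite E mulSn addn0 addn1 addSn add1n /= => -[].
  exact: squarefree_step ternary_squarefree.
- have -> : n.+2 %% 3 = 1 by lia.
  by rewrite E.
Qed.

(** The inserted letters force the period of a long square to be a multiple of
three; deleting them leaves a square of the ternary sequence. *)
Lemma quaternary_squarefree : squarefree quaternary.
Proof.
move=> x l l0 E.
have [l1|l2] : l = 1 \/ 1 < l by lia.
  by have := E 0 l0; rewrite l1 !addn0 addn1; apply: quaternary_step.
have None3 n : (quaternary n == None) = (n %% 3 == 2).
  by rewrite /quaternary; case: ifP.
have sep i : i < l -> ((x + i) %% 3 == 2) = ((x + l + i) %% 3 == 2).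
  by move=> /E e; rewrite -!None3 e.
have l3 : l %% 3 = 0.
  have [l2'|l3] : l = 2 \/ 2 < l by lia.
    by have := sep 0 l0; have := sep 1 l2; lia.
  by have := sep 0 l0; have := sep 1 l2; have := sep 2 l3; lia.
(* [pos r] is the index at which the r-th ternary letter ends up. *)
pose pos r := r %/ 2 * 3 + r %% 2.
have posE r : quaternary (pos r) = Some (ternary r).
  rewrite /quaternary /pos.
  have [-> ->] : (r %/ 2 * 3 + r %% 2) %% 3 = r %% 2
    /\ (r %/ 2 * 3 + r %% 2) %/ 3 = r %/ 2 by lia.
  by rewrite -divn_eq; case: eqP => //; lia.
(* The first ternary letter at or after index [x]. *)
pose y := x %/ 3 * 2 + x %% 3.
apply: (ternary_squarefree y (l %/ 3 * 2)); first by lia.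
move=> i lt_i; apply: Some_inj; rewrite -!posE.
have le_x : x <= pos (y + i) by rewrite /pos /y; lia.
have := E (pos (y + i) - x).
have -> : x + l + (pos (y + i) - x) = pos (y + l %/ 3 * 2 + i).
  by move: le_x; rewrite /pos; lia.
by rewrite subnKC //; apply; rewrite /pos /y; lia.
Qed.

(** * Walks on a path coloured without factors aba *)

Definition slow (f : nat -> nat) (m : nat) : Prop :=
  forall i, i.+1 < m -> f i.+1 <= (f i).+1 /\ f i <= (f i.+1).+1.

(** A discrete intermediate value theorem. *)
Lemma slow_between f m i z :
  slow f m -> i < m -> f 0 <= z <= f i \/ f i <= z <= f 0 ->
  exists2 j, j <= i & f j = z.
Proof.
move=> sf; elim: i => [|i IH] lt_im z_btw; first by exists 0; lia.
have [->|ne_z] := eqVneq z (f i.+1); first by exists i.+1.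
have [j le_ji <-] : exists2 j, j <= i & f j = z.
  by apply: IH; [lia | have := sf i lt_im; lia].
by exists j => //; exact: leqW.
Qed.

(** The displacements [x' - x] and [y' - y] are equal when [s] is true, and
opposite when it is false; written with sums to avoid truncated subtraction. *)
Definition locked (s : bool) (x x' y y' : nat) : Prop :=
  if s then x' + y = x + y' else x' + y' = x + y.

Section Walks.
Variables (A : Type) (c : nat -> A).
Hypothesis c_step : forall i, c i <> c i.+1.
Hypothesis c_no_aba : forall i, c i <> c i.+2.

Lemma close_eq x y : c x = c y -> x <= y.+2 -> y <= x.+2 -> x = y.
Proof.
have side u v : u < v -> v <= u.+2 -> c u <> c v.
  move=> lt_uv le_v; have [->|->] : v = u.+1 \/ v = u.+2 by lia.
    exact: c_step.
  exact: c_no_aba.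
case: (ltngtP x y) => // lt_xy E le1 le2; first by case: (side x y).
by case: (side y x).
Qed.

(** The colours of neighbouring vertices determine the next step of a walk, so
once the two walks have moved for the first time, one remains a translate or a
mirror image of the other.  The induction hypothesis keeps a pair [x1], [y1] of
neighbours of the current vertices, the vertices last left, which carry the
same colour and determine the mode. *)
Lemma slow_locked x y m :
  slow x m -> slow y m -> (forall i, i < m -> c (x i) = c (y i)) ->
  exists s, forall i, i < m -> locked s (x 0) (x i) (y 0) (y i).
Proof.
move=> sx sy E.
suff key i : i < m ->
    (forall j, j <= i -> x j = x 0 /\ y j = y 0)
    \/ exists s x1 y1, [/\ forall j, j <= i -> locked s (x 0) (x j) (y 0) (y j),
         locked s x1 (x i) y1 (y i), c x1 = c y1,
         x1 = (x i).+1 \/ x i = x1.+1 & y1 = (y i).+1 \/ y i = y1.+1].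
  case: m => [|m] in sx sy E key *; first by exists true.
  have [//|stay|[s [x1 [y1 [lk _ _ _ _]]]]] := key m; last by exists s.
  by exists true => i /stay [-> ->].
elim: i => [|i IH] lt_im.
  by left=> j; rewrite leqn0 => /eqP ->.
have lt_i := ltnW lt_im.
have [stepx stepy] := (sx i lt_im, sy i lt_im).
have stayE : x i.+1 = x i <-> y i.+1 = y i.
  split=> e; apply: close_eq; try lia.
    by rewrite -E // e E.
  by rewrite E // e E.
have upTo (P : nat -> Prop) : (forall j, j <= i -> P j) -> P i.+1 ->
    forall j, j <= i.+1 -> P j.
  by move=> Pi Pi1 j; rewrite leq_eqVlt ltnS => /orP[/eqP->//|/Pi].
have [ex|nx] := eqVneq (x i.+1) (x i).
  have ey := proj1 stayE ex; case: (IH lt_i) => [stay|].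
    by left; apply: upTo => //; rewrite ex ey; apply: stay.
  case=> s [x1 [y1 [lk lk1 e1 nx1 ny1]]]; right; exists s, x1, y1.
  by rewrite ex ey; split=> //; apply: upTo => //; rewrite ex ey; apply: lk.
have ny : y i.+1 <> y i by move/stayE/eqP; apply/negP.
right; case: (IH lt_i) => [stay|[s [x1 [y1 [lk lk1 e1 nx1 ny1]]]]].
  have [xi yi] := stay i (leqnn i).
  exists ((x i < x i.+1) == (y i < y i.+1)), (x i), (y i); split; try lia.
  - apply: upTo => [j /stay[-> ->]|]; rewrite /locked; case: eqP; lia.
  - by rewrite /locked; case: eqP; lia.
  - exact: E.
have e := E _ lt_im.
(* If only one of the walks turned back, the other would see the colours of
   [x1] and [y1] on both sides of its current vertex: a factor aba. *)
have lk' : locked s (x i) (x i.+1) (y i) (y i.+1).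
  have ret_x : x i.+1 = x1 -> y i.+1 = y1.
    by move=> ex; apply: close_eq; [rewrite -e ex | lia..].
  have ret_y : y i.+1 = y1 -> x i.+1 = x1.
    by move=> ey; apply: close_eq; [rewrite e ey | lia..].
  by move: lk1; rewrite /locked; case: s {lk}; lia.
exists s, (x i), (y i); split=> //; try lia; last exact: E.
apply: upTo => //; move: lk' (lk i (leqnn i)); rewrite /locked.
by case: s {lk lk1}; lia.
Qed.

(** The two halves of the walk are locked, and the first one ends next to the
place where the second one starts, so it sweeps the whole interval between the
two starting points.  If the halves are distinct translates, this shows a
square of [c]; if they are mirror images, [c] has a palindrome around the
midpoint, hence a factor aa or aba. *)
Lemma walk_repetition (f : nat -> nat) m :
  squarefree c -> slow f m.*2 -> (forall i, i < m -> c (f i) = c (f (m + i))) ->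
  forall i, i < m -> f i = f (m + i).
Proof.
move=> sqf sf E.
have sx : slow f m by move=> i lt_i; apply: sf; lia.
have sy : slow (fun i => f (m + i)) m.
  by move=> i lt_i; have := sf (m + i); rewrite addnS; apply; lia.
case: m => // m in sf E sx sy *.
have [s lk] := @slow_locked f (fun i => f (m.+1 + i)) m.+1 sx sy E.
have [stepm1 stepm2] := sf m ltac:(lia).
have [lk0 lkm] := (lk 0 isT, lk m (leqnn _)).
move: lk0 lkm; rewrite addn0 => lk0 lkm.
have agree z : f 0 <= z <= f m \/ f m <= z <= f 0 ->
    exists z', locked s (f 0) z (f m.+1) z' /\ c z = c z'.
  move=> /(slow_between _ _ _ _ sx (leqnn _)) [j le_jm <-].
  exists (f (m.+1 + j)); split; last exact: E.
  by have := lk j le_jm; rewrite addn0.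
case: s => /= in lk lk0 lkm agree *.
  have [e i|gt|lt] := ltngtP (f m.+1) (f 0).
  - have [z' [z'E _]] := agree (f m.+1).+1 ltac:(lia).
    case: (sqf z' (f 0 - f m.+1)); first by lia.
    move=> t lt_t; have [u [uE cu]] := agree ((f m.+1).+1 + t) ltac:(lia).
    have -> : z' + t = u by lia.
    by rewrite -cu; congr c; lia.
  - case: (sqf (f 0) (f m.+1 - f 0)); first by lia.
    move=> t lt_t; have [u [uE ->]] := agree (f 0 + t) ltac:(lia).
    by congr c; lia.
  - by move=> i /lk /=; rewrite addn0; lia.
(* A vertex next to the midpoint is within distance two of its mirror image. *)
have [lt|gt|e] := ltngtP (f m.+1) (f 0).
- have [z' [z'E cz]] := agree ((f 0 + f m.+1)./2).+1 ltac:(lia).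
  by have := close_eq _ _ cz; lia.
- have [z' [z'E cz]] := agree ((f 0 + f m.+1).-1)./2 ltac:(lia).
  by have := close_eq _ _ cz; lia.
(* Same starting point: a mirrored first step would show a factor aba. *)
move=> i lt_i; have lki := lk i lt_i; move: lki; rewrite /= addn0 -e => lki.
have [|ne] := eqVneq (f i) (f 0); first lia.
pose z := if f i < f 0 then (f 0).-1 else (f 0).+1.
have [j le_ji fj] : exists2 j, j <= i & f j = z.
  by apply: (slow_between _ _ _ _ sx lt_i); rewrite /z; case: ifP; lia.
have := lk j ltac:(lia); have := E j ltac:(lia); rewrite /= addn0 fj => Ej lkj.
by have := close_eq _ _ Ej; move: lkj; rewrite /z; case: ifP; lia.
Qed.
End Walks.

(** * Repetitions along paths *)

Lemma thue_number_le {G : sgraph} {T : finType} {c : G -> T} :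
  nonrepetitive c -> thue_number G <= #|T|.
Proof.
move=> nr; rewrite /thue_number; case: ex_minnP => m _; apply; apply/asboolP.
exists (enum_rank \o c) => p gp [l [l0 sz rep]].
apply: (nr p gp); exists l; split=> //; first by move: sz; rewrite !size_map.
move=> i /rep; rewrite map_comp !(onth_map _ (map c p)).
by move/(inj_omap (@enum_rank_inj T)).
Qed.

Lemma thue_number_ge (G : sgraph) b :
  (forall (T : finType) (c : G -> T), nonrepetitive c -> b <= #|T|) ->
  b <= thue_number G.
Proof.
move=> lb; rewrite /thue_number; case: ex_minnP => m /asboolP [c nr] _.
by have := lb _ c nr; rewrite card_ord.
Qed.

(** Turns the path given as a sequence into a function on indices, where the
matched positions are [i] and [l + i]. *)
Lemma nonrepetitiveI {G : sgraph} {T : Type} (c : G -> T) :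
  (forall (l : nat) (v : nat -> G), 0 < l ->
     (forall i j, i < l.*2 -> j < l.*2 -> v i = v j -> i = j) ->
     (forall i, i.+1 < l.*2 -> adj (v i) (v i.+1)) ->
     ~ (forall i, i < l -> c (v i) = c (v (l + i)))) ->
  nonrepetitive c.
Proof.
move=> H p /andP[up sp] [l [l0 + rep]]; rewrite size_map mul2n => sz.
case: p => [|v0 p] in up sp sz rep *; first by move: sz l0; case: l {rep}.
apply: (H l (nth v0 (v0 :: p)) l0).
- by move=> i j lt_i lt_j /eqP; rewrite nth_uniq ?sz // => /eqP.
- by move=> i lt_i; move/(sortedP v0): sp; apply; rewrite sz.
- move=> i lt_i; rewrite -!(nth_map v0 (c v0)) ?sz; try lia.
  by rewrite -!odflt_onth rep.
Qed.

Lemma nonrepetitive_adj {G : sgraph} {T : Type} {c : G -> T} {u v} :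
  nonrepetitive c -> adj u v -> c u <> c v.
Proof.
move=> nr uv E; apply: (nr [:: u; v]).
  rewrite /graph_path /= uv !andbT inE; apply: contraTneq uv => ->.
  by rewrite adj_irr.
by exists 1; split=> // -[|//] _ /=; rewrite E.
Qed.

Lemma nonrepetitive_abab {G : sgraph} {T : Type} {c : G -> T} {u v w z} :
  nonrepetitive c -> u <> w -> v <> z ->
  adj u v -> adj v w -> adj w z -> c u = c w -> c v <> c z.
Proof.
move=> nr /eqP uw /eqP vz uv vw wz E1 E2; apply: (nr [:: u; v; w; z]).
  have ne x y : adj x y -> x != y by apply: contraTneq => ->; rewrite adj_irr.
  have uz : u != z.
    by apply/eqP => uz; apply: (nonrepetitive_adj nr wz); rewrite -uz E1.
  by rewrite /graph_path /= uv vw wz !inE !negb_or uw uz vz !ne.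
by exists 2; split=> // -[|[|//]] _ /=; rewrite ?E1 ?E2.
Qed.

Notation layered n k := (lex_product (path_graph n) (empty_graph k)).

Lemma layered_adjE {n k} (u v : layered n k) :
  adj u v = ((u.1 : nat).+1 == v.1) || ((v.1 : nat).+1 == u.1).
Proof. by rewrite /= /lex_adj /= /empty_adj andbF orbF. Qed.

(** * The lower bound *)

Section LowerBound.
Variables (n k : nat) (T : finType) (c : layered n k -> T).
Hypothesis nr : nonrepetitive c.

(** A repeated colour in layer [j] would be a colour outside the palette of the
layers [i] and [h], on which [c] would be injective: 2k + 1 colours. *)
Lemma middle_layer_rainbow (i j h : 'I_n) (x y : 'I_k) :
  #|T| <= 2 * k -> i.+1 = j -> j.+1 = h -> c (j, x) = c (j, y) -> x = y.
Proof.
move=> cT ij jh Exy; apply/eqP/negP => /negP ne_xy.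
pose outer (b : bool) (z : 'I_k) : layered n k := (if b then i else h, z).
pose F (o : option (bool * 'I_k)) := if o is Some (b, z) then c (outer b z) else c (j, x).
pose inner t : layered n k := (j, t).
have adjj b z t : adj (outer b z) (inner t) /\ adj (inner t) (outer b z).
  by rewrite !layered_adjE /=; case: b; split; lia.
suff /leq_card : injective F by rewrite card_option card_prod card_bool card_ord; lia.
move=> [[b z]|] [[b' z']|] //= E.
- have [[-> ->]//|ne] := eqVneq (b, z) (b', z'); exfalso.
  have [a1 _] := adjj b z x; have [a2 _] := adjj b' z' y; have [_ a4] := adjj b' z' x.
  apply: (@nonrepetitive_abab _ _ c (outer b z) (inner x) (outer b' z') (inner y)
            nr _ _ a1 a4 a2 E Exy).
    move=> [ib ez]; case/eqP: ne; congr (_, _) => //.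
    by case: (b) (b') ib => -[] // /(congr1 val) /=; lia.
  by case=> /eqP; rewrite (negbTE ne_xy).
- by have [/(nonrepetitive_adj nr)] := adjj b z x; rewrite E.
- by have [_ /(nonrepetitive_adj nr)] := adjj b' z' x; rewrite E.
Qed.

Lemma layered_lower_bound : 4 <= n -> 0 < k -> 2 * k + 1 <= #|T|.
Proof.
move=> n4 k0; rewrite addn1 ltnNge; apply/negP => cT.
pose L i (lt_i4 : i < 4) : 'I_n := Ordinal (leq_trans lt_i4 n4).
pose l0 := @L 0 isT; pose l1 := @L 1 isT; pose l2 := @L 2 isT; pose l3 := @L 3 isT.
have inj1 x y := @middle_layer_rainbow l0 l1 l2 x y cT erefl erefl.
have inj2 x y := @middle_layer_rainbow l1 l2 l3 x y cT erefl erefl.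
pose inner (s : bool * 'I_k) : layered n k := (if s.1 then l1 else l2, s.2).
have inner_inj : injective (c \o inner).
  move=> [b x] [b' y]; rewrite /inner /=; case: b; case: b' => /= E.
  - by rewrite (inj1 _ _ E).
  - by case: (nonrepetitive_adj nr _ E); rewrite layered_adjE.
  - by case: (nonrepetitive_adj nr _ E); rewrite layered_adjE.
  - by rewrite (inj2 _ _ E).
have onto t : exists s, c (inner s) = t.
  have /inj_card_onto H : #|T| <= #|{: bool * 'I_k}|.
    by rewrite card_prod card_bool card_ord.
  by have /codomP [s ->] := H _ inner_inj t; exists s.
(* The outer layers draw their colours from the inner layer not adjacent to
   them, which yields a path coloured abab. *)
pose x0 : 'I_k := Ordinal k0.
have [[[] y] Ey] := onto (c (l0, x0)).
  by case: (nonrepetitive_adj nr _ Ey); rewrite layered_adjE.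
have [[[] z] Ez] := onto (c (l3, x0)); last first.
  by case: (nonrepetitive_adj nr _ Ez); rewrite layered_adjE.
by apply: (@nonrepetitive_abab _ _ c (l0, x0) (l1, z) (l2, y) (l3, x0) nr);
  rewrite ?layered_adjE.
Qed.

End LowerBound.

(** * The upper bound *)

Definition next_to (x y : nat) : Prop := y = x.+1 \/ x = y.+1.

Lemma next_to_sym {x y} : next_to x y -> next_to y x.
Proof. by case=> ->; [right | left]. Qed.

Lemma next_to_odd {x y} : next_to x y -> odd y = ~~ odd x.
Proof. by case=> ->; rewrite /= ?negbK. Qed.

Lemma next_to_block x y :
  next_to x y -> x %% 4 <> 0 -> y %% 4 <> 0 -> y %/ 4 = x %/ 4.
Proof. by rewrite /next_to; lia. Qed.

Lemma next_to_near x y :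
  next_to x y -> x %% 4 <> 2 -> y %% 4 <> 2 -> (y + 2) %/ 4 = (x + 2) %/ 4.
Proof. by rewrite /next_to; lia. Qed.

Lemma next_to_middle {x y} : next_to x y -> x %% 4 = 2 -> y %/ 4 = x %/ 4.
Proof. by rewrite /next_to; lia. Qed.

Section UpperBound.
Variables (n k q : nat) (a : nat -> 'I_q.+1).
Hypotheses (le_kq : k <= q) (a_sqf : squarefree a) (a_no_aba : forall i, a i <> a i.+2).

(** The colours of [R] are on the left, those of [X] on the right; [lift] makes
the middle layer of a block avoid the colour of the block. *)
Definition layer_color (i : nat) (x : 'I_k) : 'I_k + 'I_q.+1 :=
  if odd i then inr (a (i %/ 4))
  else if i %% 4 == 0 then inl x
  else inr (lift (a (i %/ 4)) (widen_ord le_kq x)).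

Lemma layer_color_even_inj i x y :
  ~~ odd i -> layer_color i x = layer_color i y -> x = y.
Proof.
rewrite /layer_color => /negbTE ->; case: ifP => _ [] //.
by move/(can_inj (bumpK _))/val_inj.
Qed.

Lemma layer_color_R i j x y :
  ~~ odd i -> ~~ odd j -> layer_color i x = layer_color j y ->
  (i %% 4 == 0) = (j %% 4 == 0).
Proof. by rewrite /layer_color => /negbTE -> /negbTE ->; do 2!case: ifP. Qed.

Lemma layer_color_even_odd i j x y :
  ~~ odd i -> odd j -> layer_color i x = layer_color j y ->
  i %% 4 = 2 /\ i %/ 4 <> j %/ 4.
Proof.
rewrite /layer_color => ei ->; rewrite (negbTE ei); case: ifP => // /eqP ni [E].
split; first by lia.
by move=> e; move: E; rewrite e => /esym/eqP; rewrite (negbTE (neq_lift _ _)).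
Qed.

(** The argument splits on the parity of half the length of the path: in the odd
case the path is confined to one block, in the even case to the surroundings of
one layer coloured by [R]. *)
Lemma layered_coloring_nonrepetitive :
  nonrepetitive (fun v : layered n k => layer_color v.1 v.2).
Proof.
apply: nonrepetitiveI => l v l0 v_inj v_adj E.
pose L i : nat := (v i).1.
have step i : i.+1 < l.*2 -> next_to (L i) (L i.+1).
  by move=> /v_adj; rewrite layered_adjE => /orP[] /eqP; rewrite /L; [left|right].
have first i : i < l -> i < l.*2 by clear; lia.
have second i : i < l -> l + i < l.*2 by clear; lia.
have parity i : i < l.*2 -> odd (L i) = odd (L 0 + i).
  elim: i => [|i IH] lt_i; first by rewrite addn0.
  by rewrite (next_to_odd (step i lt_i)) (IH (ltnW lt_i)) addnS.
have {}E i : i < l ->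
    layer_color (L i) (v i).2 = layer_color (L (l + i)) (v (l + i)).2 := E i.
(* A path cannot meet the same colour twice in one even layer. *)
have revisit i : i < l -> ~~ odd (L i) -> L i <> L (l + i).
  move=> lt_i ev e; have := E i lt_i; rewrite -e => /(layer_color_even_inj _ _ _ ev) e2.
  have : v i = v (l + i).
    by rewrite [v i]surjective_pairing [v (l + i)]surjective_pairing e2;
       congr (_, _); exact: val_inj.
  by move/(v_inj _ _ (first i lt_i) (second i lt_i)); move: l0; clear; lia.
case: (boolP (odd l)) => [ol|el].
  have flip i : i < l -> odd (L (l + i)) = ~~ odd (L i).
    by move=> lt_i; rewrite !parity ?second ?first // !oddD ol; do 2!case: odd.
  have noR i : i < l.*2 -> L i %% 4 <> 0.
    move=> lt_i; case: (boolP (odd (L i))) => [|ev]; first by clear; lia.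
    have [lt_il|le_li] := ltnP i l.
      have := layer_color_even_odd _ _ _ _ ev _ (E i lt_il).
      by rewrite flip ?ev // => /(_ isT) [->].
    have lt_il : i - l < l by move: lt_i le_li; clear; lia.
    have := E (i - l) lt_il; have := flip _ lt_il; rewrite subnKC // => fl /esym e.
    have := layer_color_even_odd _ _ _ _ ev _ e.
    by rewrite -[odd _]negbK -fl ev => /(_ isT) [->].
  have block i : i < l.*2 -> L i %/ 4 = L 0 %/ 4.
    elim: i => // i IH lt_i; rewrite -IH; last exact: ltnW.
    by apply: next_to_block (step i lt_i) _ _; apply: noR => //; exact: ltnW.
  have := E 0 l0; have := flip 0 l0; have := block l; rewrite addn0 => b fl e.
  have {}b : L l %/ 4 = L 0 %/ 4 by apply: b; move: l0; clear; lia.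
  case: (boolP (odd (L 0))) => o0; rewrite o0 in fl.
    by have := layer_color_even_odd _ _ _ _ (negbT fl) o0 (esym e); rewrite b => -[].
  by have := layer_color_even_odd _ _ _ _ o0 fl e; rewrite b => -[].
have same i : i < l -> odd (L (l + i)) = odd (L i).
  by move=> lt_i; rewrite !parity ?second ?first // !oddD (negbTE el).
have blockE i : i < l -> odd (L i) -> L i %/ 4 = L (l + i) %/ 4.
  (* The first index at which the path is in an odd layer. *)
  pose e0 := ~~ odd (L 0) : nat.
  move=> lt_i oi; have pi := parity i (first i lt_i).
  have := @walk_repetition _ a _ a_no_aba (fun i => L (e0 + i.*2) %/ 4) l./2 a_sqf _ _ (i./2).
  have -> : e0 + i./2.*2 = i by rewrite /e0; move: oi pi; clear; lia.
  have -> : e0 + (l./2 + i./2).*2 = l + i.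
    by rewrite /e0; move: oi pi el; clear; lia.
  apply; last by move: lt_i el; clear; lia.
  - by move=> j; apply: squarefree_step.
  - move=> j lt_j; have lt_j2 : (e0 + j.*2).+2 < l.*2.
      by rewrite /e0; move: lt_j el; clear; lia.
    have := step _ (ltnW lt_j2); have := step _ lt_j2.
    by rewrite doubleS !addnS /next_to; clear; lia.
  - move=> j lt_j; have lt_j2 : e0 + j.*2 < l.
      by rewrite /e0; move: lt_j el; clear; lia.
    have := E _ lt_j2; have -> : l + (e0 + j.*2) = e0 + (l./2 + j).*2.
      by move: el; clear; lia.
    have oj : odd (L (e0 + j.*2)).
      by rewrite parity ?first // /e0 !oddD odd_double oddb addbF; case: odd.
    have := same _ lt_j2; have -> : l + (e0 + j.*2) = e0 + (l./2 + j).*2.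
      by move: el; clear; lia.
    by rewrite /layer_color oj => -> [].
have evenP i : i < l -> ~~ odd (L i) -> ~~ odd (L (l + i)).
  by move=> lt_i; rewrite same.
have typeE i : i < l -> ~~ odd (L i) -> (L i %% 4 == 0) = (L (l + i) %% 4 == 0).
  by move=> lt_i ev; apply: layer_color_R (E i lt_i) => //; apply: evenP.
(* A neighbouring position of the same half lies in the same block as [i], and
   transfers this block to the matched position. *)
have noY i : i < l -> L i %% 4 <> 2.
  move=> lt_i Yi; have ev : ~~ odd (L i) by move: Yi; clear; lia.
  have Yli : L (l + i) %% 4 = 2.
    by move: (typeE i lt_i ev) (evenP i lt_i ev) Yi; clear; lia.
  apply: (revisit i lt_i ev).
  suff : L i %/ 4 = L (l + i) %/ 4 by move: Yi Yli; clear; lia.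
  have [lt_i1|le_i1] := ltnP i.+1 l.
    have st := step i (first _ lt_i1); have lst := step (l + i).
    rewrite -addnS in lst; have {}lst := lst (second _ lt_i1).
    rewrite -(next_to_middle st Yi) -(next_to_middle lst Yli); apply: blockE => //.
    by rewrite (next_to_odd st).
  case: i => [|i] in lt_i Yi ev Yli le_i1 *; first by move: lt_i le_i1 el; clear; lia.
  have st := step i (first _ lt_i); have lst := step (l + i).
  rewrite -addnS in lst; have {}lst := lst (second _ lt_i).
  rewrite -(next_to_middle (next_to_sym st) Yi) -(next_to_middle (next_to_sym lst) Yli).
  by apply: blockE; [exact: ltnW | rewrite (next_to_odd (next_to_sym st))].
have noY2 i : i < l.*2 -> L i %% 4 <> 2.
  have [lt_i|le_i] := ltnP i l => lt_i2; first exact: noY.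
  have lt_il : i - l < l by move: le_i lt_i2; clear; lia.
  have := noY _ lt_il; have := typeE _ lt_il; have := same _ lt_il; rewrite subnKC //.
  by clear; lia.
(* The layers that differ by at most one from a multiple [4 * q'] of four are
   those with [(L i + 2) %/ 4 = q'], apart from the middle layers. *)
have near i : i < l.*2 -> (L i + 2) %/ 4 = (L 0 + 2) %/ 4.
  elim: i => // i IH lt_i; rewrite -IH; last exact: ltnW.
  by apply: next_to_near (step i lt_i) _ _; apply: noY2 => //; exact: ltnW.
have [j [lt_j ev]] : exists j, j < l /\ ~~ odd (L j).
  have l1 : 1 < l by move: l0 el; clear; lia.
  exists (odd (L 0) : nat); split; first by case: odd.
  by rewrite parity ?first ?oddD ?oddb ?addbb //; case: odd.
apply: (revisit j lt_j ev).
have := evenP j lt_j ev; have := near _ (first _ lt_j); have := near _ (second _ lt_j).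
have := noY2 _ (first _ lt_j); have := noY2 _ (second _ lt_j).
by move: ev; clear; lia.
Qed.

End UpperBound.

(** The set [X] has at least four colours, whatever [k] is, so that it carries
the sequence [quaternary]. *)
Lemma layered_thue_le n k : thue_number (layered n k) <= k + (maxn k 3).+1.
Proof.
have le4 : #|{: option (option bool)}| <= (maxn k 3).+1.
  by rewrite !card_option card_bool; lia.
pose g := widen_ord le4 \o enum_rank.
have g_inj : injective g.
  by apply: inj_comp enum_rank_inj => i j /(congr1 val) /= /val_inj.
have := @layered_coloring_nonrepetitive n k _ (g \o quaternary) (leq_maxl k 3)
  (squarefree_inj _ _ _ _ g_inj quaternary_squarefree) _.
move=> /(_ (fun i e => quaternary_no_aba i (g_inj _ _ e))) /thue_number_le.
by rewrite card_sum !card_ord.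
Qed.

Lemma walk_monotone (f : nat -> nat) m :
  (forall i, i.+1 < m -> next_to (f i) (f i.+1)) ->
  (forall i, i.+2 < m -> f i <> f i.+2) ->
  (forall i, i < m -> f i = f 0 + i) \/ (forall i, i < m -> f i + i = f 0).
Proof.
move=> step turn; have [m2|m2] := ltnP 1 m; last first.
  by left=> i lt_i; have -> : i = 0 by [move: lt_i m2; clear; lia]; rewrite addn0.
have [up|down] := step 0 m2; [left|right].
  suff up2 i : i.+1 < m -> f i.+1 = (f i).+1.
    by elim=> [|i IH] lt_i; rewrite ?addn0 // up2 // IH ?addnS // ltnW.
  elim: i => // i IH lt_i; have := IH (ltnW lt_i).
  by move: (step _ lt_i) (turn i lt_i); rewrite /next_to; clear; lia.
suff down2 i : i.+1 < m -> f i = (f i.+1).+1.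
  by elim=> [|i IH] lt_i; rewrite ?addn0 // addnS -addSn -down2 // IH // ltnW.
elim: i => // i IH lt_i; have := IH (ltnW lt_i).
by move: (step _ lt_i) (turn i lt_i); rewrite /next_to; clear; lia.
Qed.

Lemma path_thue_le n : thue_number (layered n 1) <= 3.
Proof.
have <- : #|{: option bool}| = 3 by rewrite card_option card_bool.
apply: (@thue_number_le _ _ (fun v : layered n 1 => ternary v.1)).
apply: nonrepetitiveI => l v l0 v_inj v_adj E.
pose L i : nat := (v i).1.
have step i : i.+1 < l.*2 -> next_to (L i) (L i.+1).
  by move=> /v_adj; rewrite layered_adjE => /orP[] /eqP; rewrite /L; [left|right].
have turn i : i.+2 < l.*2 -> L i <> L i.+2.
  move=> lt_i e; have : v i = v i.+2.
    rewrite [v i]surjective_pairing [v i.+2]surjective_pairing.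
    by congr (_, _); [exact: val_inj | rewrite !ord1].
  by move/(v_inj _ _ (ltnW (ltnW lt_i)) lt_i); clear; lia.
have {}E i : i < l -> ternary (L i) = ternary (L (l + i)) := E i.
have [up|down] := walk_monotone _ _ step turn.
  apply: (ternary_squarefree (L 0) l l0) => i lt_i; have := E i lt_i.
  by rewrite up ?[L (l + i)]up ?addnA //; move: lt_i; clear; lia.
(* A decreasing path reads the square from right to left. *)
apply: (ternary_squarefree (L l.*2.-1) l l0) => i lt_i.
have ends : l.*2.-1 < l.*2 by move: l0; clear; lia.
have lt_r : l.-1 - i < l by move: lt_i; clear; lia.
have := E _ lt_r.
have -> : L (l.-1 - i) = L l.*2.-1 + l + i.
  have := down (l.-1 - i) ltac:(move: lt_r; clear; lia); have := down _ ends.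
  by move: lt_i; clear; lia.
have -> : L (l + (l.-1 - i)) = L l.*2.-1 + i.
  have := down (l + (l.-1 - i)) ltac:(move: lt_r; clear; lia); have := down _ ends.
  by move: lt_i; clear; lia.
exact: esym.
Qed.

Theorem theorem1p2 (n k : nat) (hn : 4 <= n) (hk : 1 <= k) :
  (k <> 2 ->
     thue_number (lex_product (path_graph n) (empty_graph k)) = 2 * k + 1) /\
  (k = 2 ->
     5 <= thue_number (lex_product (path_graph n) (empty_graph 2)) <= 6).
Proof.
have lb m : 0 < m -> 2 * m + 1 <= thue_number (layered n m).
  by move=> m0; apply: thue_number_ge => T c nr; apply: layered_lower_bound nr hn m0.
split=> [k2|_]; last by rewrite (lb 2) //; exact: (layered_thue_le n 2).
apply/eqP; rewrite eqn_leq lb // andbT.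
have [->|k3] : k = 1 \/ 3 <= k by lia.
  exact: path_thue_le.
by apply: leq_trans (layered_thue_le n k) _; rewrite (maxn_idPl k3); lia.
Qed.
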